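(* Let $a,b,m,n$ be nonnegative integers such that $a>0$, $b\leq a$ and $na\geq m$. Then $A(b,a;na,m)\in\mathbb{N}_0[q]$ if and only if $\gcd(a,m)\mid b$.
   Context: $\mathbb{N}$ is the set of positive integers and $\mathbb{N}_0=\mathbb{N}\cup\{0\}$. $\mathbb{N}_0[q]$ is the set of polynomials in the indeterminate $q$ with nonnegative integer coefficients. Let $(q;q)_0=1$ and $(q;q)_n=\prod_{i=1}^{n}(1-q^i)$. For $m,n\in\mathbb{N}_0$ the $q$-binomial coefficient is $\left[{n\atop m}\right]=\frac{(q;q)_n}{(q;q)_m(q;q)_{n-m}}$ if $n\geq m\geq 0$, and $0$ otherwise. For $a\in\mathbb{N}$ and $b,m,n\in\mathbb{N}_0$ define the rational function of $q$ $$A(b,a;n,m)=\frac{1-q^b}{1-q^a}\left[{n\atop m}\right].$$ The statement $A(b,a;n,m)\in\mathbb{N}_0[q]$ means that this rational function is a polynomial in $q$ with nonnegative integer coefficients. *)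

(* Defs.v *)
From mathcomp Require Import all_boot all_order all_algebra.

Set Implicit Arguments.
Unset Strict Implicit.
Unset Printing Implicit Defensive.

Import GRing.Theory.
Local Open Scope ring_scope.

Definition ratfun := {fraction {poly rat}}.

Definition q : ratfun := tofrac 'X.

(* (q; q)_n *)
Definition qpoch (n : nat) : ratfun := \prod_(1 <= i < n.+1) (1 - q ^+ i).

Definition qbinom (n m : nat) : ratfun :=
  if (m <= n)%N then qpoch n / (qpoch m * qpoch (n - m)) else 0.

(* Division by zero is total in MathComp (1 - q ^+ 0 = 0 has inverse 0), so
   this is meaningful only for 0 < a. *)
Definition A (b a n m : nat) : ratfun :=
  (1 - q ^+ b) / (1 - q ^+ a) * qbinom n m.

(* f \in N_0[q] *)
Definition is_natpoly (f : ratfun) : Prop :=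
  exists2 p : {poly rat}, p \is a polyOver Num.nat & f = tofrac p.

(* Main.v *)
Require Import Defs.
From mathcomp Require Import all_boot all_order all_fingroup all_algebra all_field.
From mathcomp Require Import zify ring.

(** Write N = n * a, g = gcd(a, m) and c = 'C(m, 2). The polynomial
      G = q^c [N choose m]_q
    is the generating function by sum of the m-element subsets of
    {0, ..., N - 1} ([gauss]; [gauss_qfact] is the product formula). Hence
    A(b, a; N, m) is the polynomial p exactly when
    (1 - q^b) G = p (1 - q^a) q^c.

    Necessity. For b > 0 compare the multiplicities of a primitive g-th root
    of unity in (1 - q^b) (q;q)_N = p (1 - q^a) (q;q)_m (q;q)_(N-m). Such a
    root is a simple root of 1 - q^i when g divides i and no root otherwise,
    so its multiplicity in (q;q)_n is n / g rounded down ([mup_qfact]). As g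
    divides both m and N, the three q-factorials cancel out; the factor
    1 - q^a contributes 1 on the right, so 1 - q^b must vanish there too.

    Sufficiency, polynomiality. The absorption identity
    (1 - q^m) [N, m] = (1 - q^N) [N-1, m-1] shows that 1 - q^a, a divisor of
    1 - q^N, divides (1 - q^m) G. It divides (1 - q^a) G trivially, and a
    Bezout relation u a = v m + g gives
    1 - q^g = (1 - q^(u a)) - q^g (1 - q^(v m)),
    so it divides (1 - q^g) G, hence (1 - q^b) G ([dvdp_subr1Xn_gauss]).

    Sufficiency, nonnegativity. The coefficients of G are symmetric and
    unimodal (Sylvester). Therefore the k-th coefficient of (1 - q^b) G is
    nonnegative up to the centre of that antisymmetric polynomial and
    nonpositive beyond it. Dividing by 1 - q^a from the low end keeps the
    lower coefficients of the quotient nonnegative, dividing from the high end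
    does the same for the upper ones, and the two ranges overlap
    ([polyOver_nat_quotient]).

    Unimodality is proved by letting sl2 act on the functions on subsets, as
    on an exterior power of an irreducible representation. The raising
    operator moves one element up by one, with the matrix coefficients of a
    unitary representation, so that the lowering operator is its transpose and
    the commutation relation reads
    |raise v|^2 = |lower v|^2 + (m (N - 1) - 2 k) |v|^2
    for v supported on the m-subsets of sum k. Below the middle the last
    coefficient is positive, so raising is injective there, and the number of
    subsets of sum k is at most the number of those of sum k + 1
    ([leq_card_level]). *)

Set Implicit Arguments.
Unset Strict Implicit.
Unset Printing Implicit Defensive.

Import Order.TTheory GRing.Theory Num.Theory.
Local Open Scope ring_scope.

(** * Raising and lowering subsets of an initial segment *)

(** The hypothesis says that the restriction of [M] to [B] x [C] is row-free, so
    its rank is #|B|, and a rank is at most the number of columns. *)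
Lemma leq_card_inj_kernel (F : fieldType) (T : finType) (B C : {set T})
    (M : T -> T -> F) :
  (forall v : T -> F, (forall s, s \notin B -> v s = 0) ->
     (forall t, t \in C -> \sum_s v s * M s t = 0) -> forall s, v s = 0) ->
  (#|B| <= #|C|)%N.
Proof.
move=> Minj.
pose X := \matrix_(i < #|B|, j < #|C|) M (enum_val i) (enum_val j).
suff /eqP <-: row_free X by apply: rank_leq_col.
apply: inj_row_free => u uX.
pose v s := \sum_(i < #|B|) u 0 i * (s == enum_val i)%:R.
have vE i : v (enum_val i) = u 0 i.
  rewrite /v (bigD1 i) //= eqxx mulr1 big1 ?addr0 // => k ki.
  by rewrite (inj_eq enum_val_inj) eq_sym (negbTE ki) mulr0.
apply/rowP => i; rewrite mxE -vE; apply: Minj.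
  move=> s sB; rewrite /v big1 // => k _; case: eqP => [e|]; last by rewrite mulr0.
  by rewrite e enum_valP in sB.
move=> t tC; transitivity ((u *m X) 0 (enum_rank_in tC t)); last by rewrite uX mxE.
rewrite mxE (bigID [in B]) /= [X in _ + X]big1 ?addr0; last first.
  move=> s sB; rewrite /v big1 ?mul0r // => k _; case: eqP => [e|]; last by rewrite mulr0.
  by rewrite e enum_valP in sB.
rewrite big_enum_val; apply: eq_bigr => k _.
by rewrite vE mxE enum_rankK_in.
Qed.

Definition mass n (S : {set 'I_n}) : nat := (\sum_(i in S) i)%N.

Definition level n m k : {set {set 'I_n}} :=
  [set S : {set 'I_n} | (#|S| == m) && (mass S == k)].

Section Raising.
Variables (R : rcfType) (n : nat).
Local Notation T := {set 'I_n.+1}.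

(** The index j stands for the pair of consecutive elements j, j + 1. *)
Definition lo (j : 'I_n) : 'I_n.+1 := widen_ord (leqnSn n) j.
Definition hi (j : 'I_n) : 'I_n.+1 := lift ord0 j.

Definition swap j (S : T) : T := [set i | tperm (lo j) (hi j) i \in S].

Lemma swapK j : involutive (swap j).
Proof. by move=> S; apply/setP => i; rewrite !inE tpermK. Qed.

Lemma lo_swap j S : (lo j \in swap j S) = (hi j \in S).
Proof. by rewrite inE tpermL. Qed.

Lemma hi_swap j S : (hi j \in swap j S) = (lo j \in S).
Proof. by rewrite inE tpermR. Qed.

Lemma lo_neq_hi j : lo j != hi j.
Proof. by rewrite -val_eqE /= /bump /=; lia. Qed.

Definition raisable j (S : T) := (lo j \in S) && (hi j \notin S).
Definition lowerable j (S : T) := (lo j \notin S) && (hi j \in S).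

Lemma raisable_swap j S : raisable j (swap j S) = lowerable j S.
Proof. by rewrite /raisable lo_swap hi_swap andbC. Qed.

Lemma lowerable_swap j S : lowerable j (swap j S) = raisable j S.
Proof. by rewrite /lowerable lo_swap hi_swap andbC. Qed.

Lemma swap_raisable j S : raisable j S -> swap j S = hi j |: (S :\ lo j).
Proof.
case/andP=> loS hiS; apply/setP => i; rewrite !inE.
by case: tpermP => [->|->|/eqP/negbTE-> /eqP/negbTE->];
  rewrite ?eqxx ?loS ?(negbTE hiS) //= (negbTE (lo_neq_hi j)).
Qed.

Lemma card_swap j S : #|swap j S| = #|S|.
Proof.
have ->: swap j S = tperm (lo j) (hi j) @^-1: S by apply/setP => i; rewrite !inE.
by rewrite on_card_preimset //; exists (tperm (lo j) (hi j)) => x _; rewrite tpermK.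
Qed.

Lemma mass_swap j S : raisable j S -> mass (swap j S) = (mass S).+1.
Proof.
move=> rS; have := rS; case/andP=> loS hiS.
rewrite swap_raisable // /mass big_setU1 ?inE ?(negbTE hiS) ?andbF //=.
by rewrite [in RHS](big_setD1 (lo j)) //= /bump /=; lia.
Qed.

(** The product of the raising coefficient j -> j + 1 and of the lowering
    coefficient j + 1 -> j in the irreducible sl2-module of dimension n + 1.
    Splitting it evenly, as the square of [coef j], makes [lower] the transpose
    of [raise]. *)
Definition weight (j : 'I_n) : nat := (j.+1 * (n - j))%N.
Definition coef j : R := Num.sqrt (weight j)%:R.

(** Operators on functions pull values back: [raise v] at S collects the values
    of v at the subsets that one upward move turns into S, whence the test that
    S itself can be lowered. *)
Definition raise (v : T -> R) (S : T) : R :=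
  \sum_j coef j * ((lowerable j S)%:R * v (swap j S)).
Definition lower (v : T -> R) (S : T) : R :=
  \sum_j coef j * ((raisable j S)%:R * v (swap j S)).

(** Indices at distance at least 2 give transpositions with disjoint supports. *)
Lemma swapC (j k : 'I_n) S : (j.+1 < k)%N -> swap j (swap k S) = swap k (swap j S).
Proof.
move=> jk; apply/setP => i; rewrite !inE -!permM.
suff -> : (tperm (lo j) (hi j) * tperm (lo k) (hi k)
          = tperm (lo k) (hi k) * tperm (lo j) (hi j))%g by [].
apply/permP => x; rewrite !permM.
have [d1 d2 d3 d4] : [/\ lo j != lo k, lo j != hi k, hi j != lo k & hi j != hi k].
  by rewrite -!val_eqE /= /bump /=; split; lia.
(* Each transposition fixes the support of the other one. *)
have [kl kh] : tperm (lo k) (hi k) (lo j) = lo j /\ tperm (lo k) (hi k) (hi j) = hi j.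
  by rewrite !tpermD // eq_sym.
have [jl jh] : tperm (lo j) (hi j) (lo k) = lo k /\ tperm (lo j) (hi j) (hi k) = hi k.
  by rewrite !tpermD.
have [->|->|/eqP x1 /eqP x2] := tpermP (lo j) (hi j) x.
- by rewrite kl kh tpermL.
- by rewrite kl kh tpermR.
by case: (tpermP (lo k) (hi k) x) => *; rewrite ?jl ?jh // tpermD // eq_sym.
Qed.

Lemma far_swap (j k : 'I_n) S : (j.+1 < k)%N \/ (k.+1 < j)%N ->
  (lo k \in swap j S) = (lo k \in S) /\ (hi k \in swap j S) = (hi k \in S).
Proof.
by move=> jk; rewrite !inE !tpermD //; rewrite -val_eqE /= /bump /=; lia.
Qed.

Lemma adj_raisable (j k : 'I_n) S : k = j.+1 :> nat -> ~~ (raisable j S && raisable k S).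
Proof.
move=> kj; have e : lo k = hi j by apply: val_inj; rewrite /= kj.
by rewrite /raisable e; case: (hi j \in S); rewrite ?andbF ?andbT.
Qed.

Lemma adj_lowerable (j k : 'I_n) S : k = j.+1 :> nat -> ~~ (lowerable j S && lowerable k S).
Proof.
move=> kj; have e : lo k = hi j by apply: val_inj; rewrite /= kj.
by rewrite /lowerable e; case: (hi j \in S); rewrite ?andbF ?andbT.
Qed.

(** The off-diagonal part of the commutation relation: distinct elementary
    raising and lowering moves commute. For adjacent indices both sides are
    zero, since the middle element would have to be both present and absent;
    for distant ones, substitute S := swap j (swap k S). *)
Lemma cross_raise_lower (j k : 'I_n) (v : T -> R) : j != k ->
  \sum_S ((lowerable j S)%:R * v (swap j S)) * ((lowerable k S)%:R * v (swap k S))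
  = \sum_S ((raisable j S)%:R * v (swap j S)) * ((raisable k S)%:R * v (swap k S)).
Proof.
wlog jk : j k / (j < k)%N => [H jk|_].
  case: (ltngtP j k) => c; first exact: H.
    under eq_bigr do rewrite mulrC; under [RHS]eq_bigr do rewrite mulrC.
    by apply: H; rewrite // eq_sym.
  by move/eqP: jk; case; apply: val_inj.
have [kj|kj] := eqVneq (k : nat) j.+1.
  rewrite !big1 // => S _; rewrite mulrACA -natrM mulnb.
    by rewrite (negbTE (adj_raisable S kj)) mul0r.
  by rewrite (negbTE (adj_lowerable S kj)) mul0r.
have {}jk : (j.+1 < k)%N by lia.
rewrite (reindex_inj (inv_inj (swapK k))) (reindex_inj (inv_inj (swapK j))) /=.
apply: eq_bigr => S _.
have far (l l' : 'I_n) S' : (l.+1 < l')%N \/ (l'.+1 < l)%N ->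
    raisable l' (swap l S') = raisable l' S'.
  by move=> ll'; rewrite /raisable; have [-> ->] := far_swap S' ll'.
have e := swapC S jk.
rewrite swapK (lowerable_swap k) (far j k); last by left.
by rewrite -e swapK (lowerable_swap j) (far k j); [ring | right].
Qed.

(** Expanding both squared norms, the cross terms agree by
    [cross_raise_lower]; the diagonal ones count whether the move at j is
    possible upwards or downwards, and the subsets containing both or neither
    of j and j + 1 cancel. *)
Lemma norm_raise_lower (v : T -> R) :
  \sum_S raise v S ^+ 2 = \sum_S lower v S ^+ 2 +
    \sum_S v S ^+ 2 * \sum_j (weight j)%:R * ((lo j \in S)%:R - (hi j \in S)%:R).
Proof.
have sqE (p : 'I_n -> T -> bool) : \sum_S (\sum_j coef j * ((p j S)%:R * v (swap j S))) ^+ 2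
  = \sum_j \sum_k coef j * coef k *
      \sum_S ((p j S)%:R * v (swap j S)) * ((p k S)%:R * v (swap k S)).
  under eq_bigr => S _.
    rewrite expr2 mulr_suml; under eq_bigr do rewrite mulr_sumr; over.
  rewrite exchange_big; apply: eq_bigr => j _; rewrite exchange_big.
  apply: eq_bigr => k _; rewrite mulr_sumr; apply: eq_bigr => S _; ring.
rewrite /raise /lower !sqE.
under [X in _ + X]eq_bigr do rewrite mulr_sumr.
rewrite [X in _ = _ + X]exchange_big -big_split; apply: eq_bigr => j _ /=.
rewrite (bigD1 j) //= [in RHS](bigD1 j) //=.
rewrite [X in _ + X = _](eq_bigr (fun k => coef j * coef k * \sum_S
   ((raisable j S)%:R * v (swap j S)) * ((raisable k S)%:R * v (swap k S)))); last first.
  by move=> k kj; rewrite cross_raise_lower // eq_sym.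
rewrite [RHS]addrAC; congr (_ + _).
have -> : coef j * coef j = (weight j)%:R by rewrite -expr2 sqr_sqrtr ?ler0n.
rewrite (reindex_inj (inv_inj (swapK j))).
rewrite [X in _ = _ * X + _](reindex_inj (inv_inj (swapK j))) /=.
rewrite !mulr_sumr -big_split; apply: eq_bigr => S _ /=.
rewrite lowerable_swap raisable_swap swapK /raisable /lowerable.
by case: (lo j \in S); case: (hi j \in S) => /=; ring.
Qed.

(** Abel summation: the weight extends by 0 to j = -1 and j = n, and
    weight i - weight (i - 1) = n - 2 i, so that the sum is the sl2-weight of
    the subset. *)
Lemma sum_weight (S : T) :
  \sum_j (weight j)%:R * ((lo j \in S)%:R - (hi j \in S)%:R)
  = \sum_(i in S) (n%:R - 2 * i%:R) :> R.
Proof.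
under eq_bigr do rewrite mulrBr.
rewrite sumrB [RHS]big_mkcond /=.
have -> : \sum_j (weight j)%:R * (lo j \in S)%:R =
   \sum_(i < n.+1) (i.+1%:R * (n%:R - i%:R)) * (i \in S)%:R :> R.
  rewrite big_ord_recr /= subrr mulr0 mul0r addr0; apply: eq_bigr => i _.
  by rewrite natrM natrB // ltnW.
have -> : \sum_j (weight j)%:R * (hi j \in S)%:R =
   \sum_(i < n.+1) (i%:R * (n%:R - i%:R + 1)) * (i \in S)%:R :> R.
  rewrite big_ord_recl /= !mul0r add0r; apply: eq_bigr => i _.
  rewrite natrM natrB 1?ltnW //= /bump /= add1n -natr1.
  by rewrite -/(hi i); ring.
rewrite -sumrB; apply: eq_bigr => i _; case: (i \in S) => /=; rewrite -?natr1; ring.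
Qed.

(** A function on the level k killed by raising has
    0 = |lower v|^2 + (m n - 2 k) |v|^2, hence vanishes when 2 k < m n. *)
Lemma leq_card_level m k : (2 * k < m * n)%N ->
  (#|level n.+1 m k| <= #|level n.+1 m k.+1|)%N.
Proof.
move=> km.
pose M S S' : R := \sum_j coef j * ((lowerable j S')%:R * (S == swap j S')%:R).
apply: (@leq_card_inj_kernel R _ _ _ M) => v v0 Mv0.
have raiseE S' : raise v S' = \sum_S v S * M S S'.
  under [RHS]eq_bigr do rewrite mulr_sumr.
  rewrite exchange_big; apply: eq_bigr => j _.
  rewrite (bigD1 (swap j S')) //= big1 => [|S /negbTE->]; last by rewrite !mulr0.
  by rewrite eqxx mulr1 addr0 [RHS]mulrCA [X in _ = _ * X]mulrC.
have raise0 S' : raise v S' = 0.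
  have [S'k|S'k] := boolP (S' \in level n.+1 m k.+1); first by rewrite raiseE Mv0.
  rewrite /raise big1 // => j _; case lS': (lowerable j S'); last by rewrite mul0r mulr0.
  rewrite v0 ?mulr0 //; apply: contra S'k; rewrite !inE card_swap.
  by case/andP=> -> /eqP <-; rewrite -(mass_swap (j := j)) ?raisable_swap // swapK /=.
have := norm_raise_lower v; rewrite big1; last by move=> S _; rewrite raise0 expr0n.
have gap : 0 < (m * n)%:R - 2 * k%:R :> R by rewrite subr_gt0 -natrM ltr_nat.
have -> : \sum_S v S ^+ 2 * \sum_j (weight j)%:R * ((lo j \in S)%:R - (hi j \in S)%:R)
    = \sum_S v S ^+ 2 * ((m * n)%:R - 2 * k%:R).
  apply: eq_bigr => S _.
  have [|/v0->] := boolP (S \in level n.+1 m k); last by rewrite expr2 !mul0r.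
  rewrite inE sum_weight sumrB sumr_const => /andP[/eqP-> /eqP<-].
  by rewrite -mulr_sumr -natr_sum natrM mulr_natl.
have ge0 (f : T -> R) : 0 <= \sum_S f S ^+ 2 by apply: sumr_ge0 => S _; apply: sqr_ge0.
rewrite -mulr_suml => /esym/eqP; rewrite paddr_eq0 ?mulr_ge0 ?(ltW gap) ?ge0 //.
case/andP=> _; rewrite mulf_eq0 (gt_eqF gap) orbF psumr_eq0 => [|S _]; last exact: sqr_ge0.
by move=> /allP v0' s; have := v0' s (mem_index_enum s); rewrite sqrf_eq0 => /eqP.
Qed.
End Raising.

(** * Symmetry and unimodality of the level sizes *)

Lemma card_rev n (S : {set 'I_n}) : #|[set rev_ord i | i in S]| = #|S|.
Proof. by rewrite card_imset //; apply: rev_ord_inj. Qed.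

Lemma mass_rev n (S : {set 'I_n}) :
  (mass S + mass [set rev_ord i | i in S] = #|S| * n.-1)%N.
Proof.
rewrite /mass big_imset /=; last by move=> i j _ _; apply: rev_ord_inj.
rewrite -big_split -sum_nat_const; apply: eq_bigr => i _ /=; have := ltn_ord i; lia.
Qed.

(** Reversing the segment maps subsets of sum k to subsets of the
    complementary sum. *)
Lemma leq_level_rev n m k l : (k + l = m * n.-1)%N ->
  (#|level n m k| <= #|level n m l|)%N.
Proof.
move=> kl.
have rinj : injective (fun S : {set 'I_n} => [set rev_ord i | i in S]).
  by apply: imset_inj; apply: rev_ord_inj.
rewrite -(card_imset _ rinj) subset_leq_card //.
apply/subsetP => _ /imsetP[S + ->]; rewrite !inE card_rev => /andP[/eqP Sm /eqP Sk].
by have := mass_rev S; rewrite Sm Sk eqxx /=; lia.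
Qed.

Lemma level_sym n m k l : (k + l = m * n.-1)%N -> #|level n m k| = #|level n m l|.
Proof. by move=> kl; apply/eqP; rewrite eqn_leq !leq_level_rev // addnC. Qed.

Lemma level_eq0 n m k : (m * n.-1 < k)%N -> #|level n m k| = 0%N.
Proof.
move=> km; apply/eqP; rewrite cards_eq0 -subset0; apply/subsetP => S.
rewrite !inE => /andP[/eqP Sm /eqP Sk].
have := mass_rev S; rewrite Sm Sk; lia.
Qed.

(** The square roots in [raise] only ask for some real closed field: the real
    algebraic numbers serve. *)
Lemma leq_level_step n m k : (2 * k < m * n.-1)%N ->
  (#|level n m k| <= #|level n m k.+1|)%N.
Proof.
case: n => [|n] km; first by rewrite muln0 in km.
exact: (leq_card_level algR).
Qed.

(** Symmetry turns step-by-step monotonicity into a comparison of any two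
    sums i <= j: their midpoint decides which one is nearer to the centre. *)
Lemma leq_level_center n m i j : (i <= j)%N -> (i + j <= m * n.-1)%N ->
  (#|level n m i| <= #|level n m j|)%N.
Proof.
have up i' j' : (i' <= j')%N -> (2 * j' <= m * n.-1)%N ->
    (#|level n m i'| <= #|level n m j'|)%N.
  move/subnK <-; elim: (j' - i')%N => // d IH le.
  by rewrite (leq_trans (IH _)) ?leq_level_step //; lia.
move=> ij ijD; have [jD|jD] := leqP (2 * j) (m * n.-1); first exact: up.
by rewrite (@level_sym _ _ j (m * n.-1 - j)) ?up //; lia.
Qed.

Lemma geq_level_center n m i j : (i <= j)%N -> (m * n.-1 <= i + j)%N ->
  (#|level n m j| <= #|level n m i|)%N.
Proof.
move=> ij ijD; have [jD|jD] := leqP j (m * n.-1); last by rewrite level_eq0.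
rewrite (@level_sym _ _ j (m * n.-1 - j)) ?(@level_sym _ _ i (m * n.-1 - i)); try lia.
by apply: leq_level_center; lia.
Qed.

(** * Gaussian polynomials as generating functions of subsets *)

Section Gauss.
Variable R : comNzRingType.

Definition gauss n m : {poly R} := \sum_(S : {set 'I_n} | #|S| == m) 'X^(mass S).

Lemma coef_gauss n m k : (gauss n m)`_k = #|level n m k|%:R.
Proof.
rewrite /gauss coef_sum -sum1_card natr_sum.
rewrite [RHS]big_mkcond [LHS]big_mkcond; apply: eq_bigr => S _.
by rewrite inE coefXn (eq_sym k); case: (_ == m); case: (mass S == k).
Qed.

Lemma gauss_gt n m : (n < m)%N -> gauss n m = 0.
Proof.
move=> nm; rewrite /gauss big1 // => S /eqP Sm.
by have := max_card S; rewrite card_ord Sm leqNgt nm.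
Qed.

(** The q-binomial theorem: the outer variable records the cardinality. It
    yields the Pascal recurrence [gaussS] by peeling off the last factor. *)
Lemma prod_gauss n : \prod_(i < n) (('X^i)%:P * 'X + 1) =
  \sum_(S : {set 'I_n}) ('X^(mass S))%:P * 'X^#|S| :> {poly {poly R}}.
Proof.
rewrite bigA_distr; apply: eq_bigr => S _.
rewrite -big_mkcond /= big_split /= prodr_const; congr (_ * _).
by rewrite /mass -rmorph_prod /= -prodrXr.
Qed.

Lemma gauss_coef n m : gauss n m = (\prod_(i < n) (('X^i)%:P * 'X + 1))`_m.
Proof.
rewrite prod_gauss coef_sum /gauss [LHS]big_mkcond; apply: eq_bigr => S _.
by rewrite coefCM coefXn (eq_sym m); case: eqP; rewrite ?mulr1 ?mulr0.
Qed.

Lemma gaussS n m : gauss n.+1 m.+1 = gauss n m.+1 + 'X^n * gauss n m.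
Proof.
by rewrite !gauss_coef big_ord_recr /= mulrDr mulr1 mulrA coefD coefMX /= coefMC mulrC addrC.
Qed.

Lemma gauss0 n : gauss n 0 = 1.
Proof.
rewrite /gauss (eq_bigl (pred1 set0)) => [|S]; last by rewrite cards_eq0.
by rewrite big_pred1_eq /mass big_set0.
Qed.

Definition qfact n : {poly R} := \prod_(1 <= i < n.+1) (1 - 'X^i).

Lemma qfactS n : qfact n.+1 = qfact n * (1 - 'X^(n.+1)).
Proof. by rewrite /qfact big_nat_recr. Qed.

(** This identifies [gauss n m] with q^'C(m, 2) times the q-binomial
    coefficient, 'C(m, 2) being the least sum of m distinct naturals. *)
Lemma gauss_qfact n m : (m <= n)%N ->
  gauss n m * (qfact m * qfact (n - m)) = 'X^'C(m, 2) * qfact n.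
Proof.
elim: n m => [|n IH] [|m] // mn; try by rewrite gauss0 ?subn0 /qfact big_geq // !mul1r.
rewrite gaussS mulrDl subSS.
have := IH m mn; rewrite qfactS binS bin1 exprD => IHm.
have [nm|{}mn] := leqP n m.
  have {nm mn} e : m = n by apply/eqP; rewrite eqn_leq nm -ltnS mn.
  rewrite e in IHm *; rewrite (gauss_gt (ltnSn n)) // mul0r add0r qfactS.
  transitivity (('X^n : {poly R}) * (1 - 'X^(n.+1)) *
    (gauss n n * (qfact n * qfact (n - n)))); first by ring.
  by rewrite IHm; ring.
have := IH m.+1 mn; rewrite qfactS binS bin1 exprD => IHm1.
have nmE : (n - m = (n - m.+1).+1)%N by lia.
rewrite nmE !qfactS -nmE in IHm *.
have -> : ('X^(n.+1) : {poly R}) = 'X^(n - m) * 'X^(m.+1).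
  by rewrite -exprD; congr (_ ^+ _); lia.
have XnE : ('X^n : {poly R}) = 'X^(n - m) * 'X^m by rewrite -exprD subnK // ltnW.
transitivity ((1 - 'X^(n - m)) *
    (gauss n m.+1 * (qfact m * (1 - 'X^(m.+1)) * qfact (n - m.+1)))
  + 'X^n * (1 - 'X^(m.+1)) * (gauss n m * (qfact m * (qfact (n - m.+1) * (1 - 'X^(n - m)))))).
  by ring.
by rewrite IHm IHm1 XnE; ring.
Qed.
End Gauss.

(** * Clearing denominators *)

Lemma subr1Xn_neq0 (F : nzRingType) n : (0 < n)%N -> 1 - 'X^n != 0 :> {poly F}.
Proof. by move=> n0; rewrite -opprB oppr_eq0 -size_poly_eq0 size_XnsubC. Qed.

Lemma qfact_neq0 (F : fieldType) n : qfact F n != 0.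
Proof.
elim: n => [|n IH]; first by rewrite /qfact big_geq // oner_neq0.
by rewrite qfactS mulf_neq0 // subr1Xn_neq0.
Qed.

Lemma tofrac_qfact n : qpoch n = tofrac (qfact rat n).
Proof.
rewrite /qpoch /qfact rmorph_prod; apply: eq_bigr => i _.
by rewrite rmorphB rmorph1 rmorphXn.
Qed.

Lemma A_eq_tofrac (a b N m : nat) (p : {poly rat}) : (0 < a)%N -> (m <= N)%N ->
  A b a N m = tofrac p <->
  (1 - 'X^b) * qfact rat N = p * (1 - 'X^a) * (qfact rat m * qfact rat (N - m)).
Proof.
move=> a0 mN; rewrite /A /qbinom mN !tofrac_qfact /q -!tofracXn -tofrac1 -!tofracB -tofracM.
rewrite mulf_div -!tofracM.
have d0 : tofrac ((1 - 'X^a) * (qfact rat m * qfact rat (N - m))) != 0.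
  by rewrite tofrac_eq0 !mulf_neq0 ?subr1Xn_neq0 ?qfact_neq0.
split=> [/(canRL (mulfVK d0))|e].
  by rewrite -tofracM mulrA => /eqP; rewrite tofrac_eq => /eqP.
by apply: (canLR (mulfK d0)); rewrite e -tofracM !mulrA.
Qed.

(** * Multiplicities of roots of unity *)

Section Multiplicity.
Variables (F : fieldType) (g : nat) (z : F).
Hypotheses (F0 : [pchar F] =i pred0) (zP : g.-primitive_root z).

(** In characteristic 0 the polynomial 'X^n - 1 is separable, so its roots are
    simple. *)
Lemma mup_subr1Xn n : (0 < n)%N -> mup z (1 - 'X^n) = (g %| n)%N.
Proof.
move=> n0; have nz := @subr1Xn_neq0 F n n0.
have rE : root (1 - 'X^n) z = (g %| n)%N.
  by rewrite /root !hornerE subr_eq0 eq_sym (prim_order_dvd zP).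
case gn: (g %| n)%N; last by rewrite mupNroot // rE gn.
apply/eqP; rewrite eqn_leq mup_leq // mup_geq // expr1 dvdp_XsubCl rE gn andbT.
rewrite -dvdpNr opprB separable_nosquare ?size_XsubC //.
by apply: separable_Xn_sub_1; move/pcharf0P: F0 => ->; rewrite -lt0n.
Qed.

(** Each multiple of g among 1, ..., n contributes one simple factor. *)
Lemma mup_qfact n : mup z (qfact F n) = (n %/ g)%N.
Proof.
elim: n => [|n IH]; first by rewrite /qfact big_geq // div0n mupNroot // rootC oner_neq0.
rewrite qfactS mupM ?qfact_neq0 ?subr1Xn_neq0 // IH mup_subr1Xn //.
by rewrite divnS ?(prim_order_gt0 zP) // addnC.
Qed.
End Multiplicity.

Lemma gcdn_dvdn_of_quotient (a b N m : nat) (p : {poly rat}) :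
  (0 < a)%N -> (m <= N)%N -> (a %| N)%N ->
  (1 - 'X^b) * qfact rat N = p * (1 - 'X^a) * (qfact rat m * qfact rat (N - m)) ->
  (gcdn a m %| b)%N.
Proof.
move=> a0 mN aN e; case: (posnP b) => [->|b0]; first exact: dvdn0.
have g0 : (0 < gcdn a m)%N by rewrite gcdn_gt0 a0.
have [z zP] := C_prim_root_exists g0.
have ratXn n : map_poly ratr (1 - 'X^n : {poly rat}) = 1 - 'X^n :> {poly algC}.
  by rewrite rmorphB rmorph1 /= map_polyXn.
have ratq n : map_poly ratr (qfact rat n) = qfact algC n.
  by rewrite /qfact rmorph_prod; apply: eq_bigr => i _; apply: ratXn.
have p0 : map_poly (ratr : rat -> algC) p != 0.
  rewrite map_poly_eq0; apply: contra_eq_neq e => ->.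
  by rewrite !mul0r mulf_neq0 ?subr1Xn_neq0 ?qfact_neq0.
have := congr1 (map_poly (ratr : rat -> algC)) e.
rewrite !rmorphM /= !ratXn !ratq => /(congr1 (mup z)).
rewrite !mupM ?mulf_neq0 ?subr1Xn_neq0 ?qfact_neq0 //.
rewrite !(mup_qfact (@pchar_num _) zP) !(mup_subr1Xn (@pchar_num _) zP) //.
rewrite dvdn_gcdl -divnDl ?dvdn_gcdr // subnKC //.
by case: (_ %| b)%N => //=; lia.
Qed.

(** * Divisibility by 1 - q^a *)

Lemma dvdp_subr1Xn (F : fieldType) a b : (a %| b)%N -> (1 - 'X^a : {poly F}) %| 1 - 'X^b.
Proof.
case/dvdnP=> k ->; rewrite mulnC exprM -{2}(expr1n _ k) subrXX.
exact: dvdp_mulIl.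
Qed.

(** Up to the powers of q, the identity
    (1 - q^m) [n, m] = (1 - q^n) [n - 1, m - 1]. *)
Lemma gauss_absorption (F : fieldType) n m : (m <= n)%N ->
  (1 - 'X^(m.+1)) * gauss F n.+1 m.+1 = 'X^m * (1 - 'X^(n.+1)) * gauss F n m.
Proof.
move=> mn; have Q0 : qfact F m * qfact F (n - m) != 0 by rewrite mulf_neq0 ?qfact_neq0.
apply: (mulIf Q0); rewrite -['X^m * _ * _ * _]mulrA gauss_qfact //.
have := @gauss_qfact F n.+1 m.+1 mn; rewrite subSS !qfactS binS bin1 exprD => e.
transitivity (gauss F n.+1 m.+1 * (qfact F m * (1 - 'X^(m.+1)) * qfact F (n - m))).
  by ring.
by rewrite e; ring.
Qed.

(** Bezout on exponents: an ideal containing 1 - q^a and 1 - q^m contains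
    1 - q^gcd(a, m); here the ideal is that of the multipliers of [gauss F N m]
    into the multiples of 1 - q^a. *)
Lemma dvdp_subr1Xn_gauss (F : fieldType) (a b N m : nat) : (0 < a)%N -> (m <= N)%N ->
  (a %| N)%N -> (gcdn a m %| b)%N -> 1 - 'X^a %| (1 - 'X^b) * gauss F N m.
Proof.
move=> a0 mN aN gb; apply: dvdp_trans (dvdp_mul (dvdp_subr1Xn F gb) (dvdpp _)).
have dm : 1 - 'X^a %| (1 - 'X^m) * gauss F N m.
  case: m mN {gb} => [|m]; first by rewrite subrr mul0r dvdp0.
  case: N aN => // N aN mN; rewrite gauss_absorption //.
  by rewrite dvdp_mulr // dvdp_mull // dvdp_subr1Xn.
have [u v e _] := egcdnP m a0.
have -> : 1 - 'X^(gcdn a m) = (1 - 'X^(u * a)) - 'X^(gcdn a m) * (1 - 'X^(v * m)) :> {poly F}.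
  by rewrite e exprD; ring.
rewrite mulrBl dvdp_sub //; first by rewrite dvdp_mulr // dvdp_subr1Xn // dvdn_mull.
rewrite -mulrA dvdp_mull //; apply: dvdp_trans dm _.
by apply: dvdp_mul (dvdpp _); rewrite dvdp_subr1Xn // dvdn_mull.
Qed.

Lemma coprimep_Xn_subr1Xn (F : fieldType) k i : (0 < i)%N ->
  coprimep ('X^k : {poly F}) (1 - 'X^i).
Proof.
move=> i0; apply: coprimep_expl.
rewrite coprimep_sym coprimepX /root !hornerE expr0n.
by rewrite (gtn_eqF i0) subr0 oner_neq0.
Qed.

Lemma coprimep_Xn_qfact (F : fieldType) k n : coprimep ('X^k) (qfact F n).
Proof.
elim: n => [|n IH]; first by rewrite /qfact big_geq // coprimep1.
by rewrite qfactS coprimepMr IH coprimep_Xn_subr1Xn.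
Qed.

(** By [gauss_qfact], as q-factorials have constant term 1. *)
Lemma dvdp_Xn_gauss (F : fieldType) n m : (m <= n)%N -> 'X^'C(m, 2) %| gauss F n m.
Proof.
move=> mn.
rewrite -(Gauss_dvdpl _ (q := qfact F m * qfact F (n - m))) ?coprimepMr ?coprimep_Xn_qfact //.
by rewrite gauss_qfact // dvdp_mulIl.
Qed.

(** * Nonnegativity of the quotient *)

(** [f] is unimodal about D / 2, in the form of pairwise comparisons. The
    coefficients of [r] obey r_k = r_(k-a) + f k - f (k-b). Reading it upwards
    from r_k = 0 for k < 0 gives r_k >= 0 as long as 2 k <= D + b; reading it
    downwards from r_k = 0 for large k gives r_k >= 0 when
    2 (k + a) >= D + b. *)
Lemma polyOver_nat_quotient (f : nat -> nat) (D a b : nat) (P r : {poly rat}) :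
  (forall i j, i <= j -> i + j <= D -> f i <= f j)%N ->
  (forall i j, i <= j -> D <= i + j -> f j <= f i)%N ->
  (forall k, D < k -> f k = 0)%N ->
  (forall k, P`_k = (f k)%:R) -> (0 < a)%N ->
  r * (1 - 'X^a) = (1 - 'X^b) * P -> r \is a polyOver Num.nat.
Proof.
move=> up down f0 PE a0 e.
have rE k : r`_k = (if (k < a)%N then 0 else r`_(k - a)) +
    ((f k)%:R - (if (k < b)%N then 0 else (f (k - b)%N)%:R)).
  have := congr1 (fun s : {poly rat} => s`_k) e.
  rewrite /= mulrBr mulr1 mulrBl mul1r !coefB coefMXn coefXnM !PE => <-.
  by rewrite addrC subrK.
have rint k : r`_k \is a Num.int.
  have [n] := ubnP k; elim: n k => // n IH k kn; rewrite rE rpredD //.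
    by case: ltnP => // ak; apply: IH; lia.
  by rewrite rpredB ?rpred_nat //; case: ifP => _; rewrite ?rpred0 ?rpred_nat.
have rup k : (2 * k <= D + b)%N -> 0 <= r`_k.
  have [n] := ubnP k; elim: n k => // n IH k kn kD; rewrite rE addr_ge0 //.
    by case: ltnP => // ak; apply: IH; lia.
  by rewrite subr_ge0; case: ltnP => bk //; rewrite ler_nat up //; lia.
have rdown k : (D + b <= 2 * (k + a))%N -> 0 <= r`_k.
  have [n] := ubnP (size r - k)%N; elim: n k => // n IH k kn kD.
  have [rk|rk] := leqP (size r) k; first by rewrite nth_default.
  (* Solve the recurrence at k + a for r_k. *)
  have := rE (k + a)%N; rewrite ltnNge leq_addl /= addnK => /esym/(canRL (addrK _)) ->.
  rewrite subr_ge0 (@le_trans _ _ 0) //; last by apply: IH; lia.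
  rewrite subr_le0; case: ltnP => bk; first by rewrite f0 //; lia.
  by rewrite ler_nat down //; lia.
apply/polyOverP => k; rewrite natrEint rint /=.
by have [/rup//|kD] := leqP (2 * k)%N (D + b)%N; apply: rdown; lia.
Qed.

(** Both divisors of (1 - q^b) G, the polynomial 1 - q^a and the power of q
    that turns G into the q-binomial coefficient, are coprime, so their product
    divides it; the coefficients of the quotient are then read off from those
    of G. *)
Lemma is_natpoly_A (a b m N : nat) : (0 < a)%N -> (m <= N)%N -> (a %| N)%N ->
  is_natpoly (A b a N m) <-> (gcdn a m %| b)%N.
Proof.
move=> a0 mN aN.
split=> [[p _ /A_eq_tofrac e]|gb]; first by apply: gcdn_dvdn_of_quotient (e _ _).
have /dvdpP[p pE] : (1 - 'X^a) * 'X^'C(m, 2) %| (1 - 'X^b) * gauss rat N m.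
  rewrite Gauss_dvdp; last by rewrite coprimep_sym coprimep_Xn_subr1Xn.
  by rewrite dvdp_subr1Xn_gauss // dvdp_mull // dvdp_Xn_gauss.
exists p.
  have /polyOverP rnat : p * 'X^'C(m, 2) \is a polyOver Num.nat.
    apply: (@polyOver_nat_quotient (fun k => #|level N m k|) (m * N.-1) a b
      (gauss rat N m)) => //.
    - exact: leq_level_center.
    - exact: geq_level_center.
    - exact: level_eq0.
    - exact: coef_gauss.
    by rewrite pE; ring.
  apply/polyOverP => k; have := rnat (k + 'C(m, 2))%N.
  by rewrite coefMXn ltnNge leq_addl /= addnK.
apply/A_eq_tofrac => //.
have X0 : 'X^'C(m, 2) != 0 :> {poly rat} by rewrite expf_neq0 ?polyX_eq0.
apply: (mulfI X0); rewrite mulrCA -gauss_qfact // [LHS]mulrA pE; ring.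
Qed.

Local Close Scope ring_scope.

Theorem corollary2 (a b m n : nat) (a_gt0 : 0 < a) (le_b_a : b <= a)
    (le_m_na : m <= n * a) :
  is_natpoly (A b a (n * a) m) <-> gcdn a m %| b.
Proof. by apply: is_natpoly_A => //; apply: dvdn_mull. Qed.
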